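(* Let $k$ be a positive integer and let $r$ be a positive integer with $r \leq (k-1)/2$. Then every finite simple undirected graph $G$ with $2e(G) > (k-1)v(G)$ (i.e., average degree strictly greater than $k-1$) contains, as a subgraph, a keyring $C_r(l)$ with $r$ leaves and at least $k$ edges (i.e., with $l + r \geq k$).
   Context: For a graph $G$, $v(G)$ and $e(G)$ denote the numbers of vertices and edges. A keyring $C_r(l)$ is the $(l+r)$-edge graph obtained from a cycle of length $l$ by appending $r$ new leaves (pendant vertices) to one of the vertices of the cycle; that vertex is called the center. *)

(* Defs.v *)
From mathcomp Require Import all_boot.

Set Implicit Arguments.
Unset Strict Implicit.
Unset Printing Implicit Defensive.

Record sgraph := SGraph {
  vertex :> finType;
  adj : rel vertex;
  adj_sym : symmetric adj;
  adj_irrefl : irreflexive adj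
}.

Definition num_vertices (G : sgraph) : nat := #|G|.

Definition edges (G : sgraph) : {set {set G}} :=
  [set [set p.1; p.2] | p : G * G & adj p.1 p.2].

Definition num_edges (G : sgraph) : nat := #|edges G|.

(* Subgraph up to isomorphism, not necessarily induced. *)
Definition contains (G H : sgraph) : Prop :=
  exists f : H -> G, injective f /\ {homo f : x y / adj x y}.

Section Keyring.
Variables l r : nat.

(* [inl i] is the i-th vertex of the cycle and [inr j] the j-th leaf; the
   center is the cycle vertex 0. [ordS] is the successor modulo [l].
   This is a cycle with leaves only for [3 <= l]; the conjunct [i != j] is then
   redundant, and only serves to exclude the loop that would arise for [l = 1]. *)
Definition keyring_adj (x y : 'I_l + 'I_r) : bool :=
  match x, y with
  | inl i, inl j => (i != j) && ((j == ordS i) || (i == ordS j))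
  | inl i, inr _ | inr _, inl i => val i == 0
  | inr _, inr _ => false
  end.

Lemma keyring_adj_sym : symmetric keyring_adj.
Proof. by move=> [i|i] [j|j] //=; rewrite eq_sym orbC. Qed.

Lemma keyring_adj_irrefl : irreflexive keyring_adj.
Proof. by move=> [i|i] //=; rewrite eqxx. Qed.

Definition keyring : sgraph := SGraph keyring_adj_sym keyring_adj_irrefl.

End Keyring.

(* Main.v *)
Require Import Defs.
From mathcomp Require Import all_boot.
From mathcomp Require Import zify.

Set Implicit Arguments.
Unset Strict Implicit.
Unset Printing Implicit Defensive.

(** Let k >= 4 and choose a minimal nonempty vertex set A whose induced graph
    satisfies 2e > (k-1)(n-1). By minimality this graph is 2-connected with
    minimum degree at least k/2, and some vertex v has degree at least k-1 in
    it. Take a longest cycle C through v. If v has a neighbour off C, the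
    argument of Erdős and Gallai yields a long path from v through a component
    of A - C whose end has neighbours on C - v, and maximality of C gives
    |C| >= k; otherwise C contains v and its k-1 neighbours. So |C| >= k
    either way. Now if v has r neighbours off C we are done; otherwise shorten
    C along a chord at v so that exactly r of the at least k-1 neighbours of v
    lie outside: the new cycle has at least k-r vertices. *)

(** * Long paths through a set with no small cuts *)

(* Think of [w u] as the number of edges from [u] to one more vertex, obtained
   by contracting everything outside [x |: D]; the two cut hypotheses say that
   every nonempty subset of [D] has at least two outer neighbours in the
   contracted graph. The induction removes [x] and passes to a minimal set [S]
   that then has a single outer neighbour: either the contracted vertex
   ([closedA]) or some [c] in [D] ([closedB]). *)
Lemma long_exit_path (T : finType) (e : rel T) (D : {set T}) (x : T)
    (w : T -> nat) (d : nat) :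
  symmetric e -> irreflexive e -> x \notin D -> D != set0 ->
  (forall S : {set T}, S \subset D -> S != set0 ->
     exists u y, [/\ u \in S, y \in x |: D, y \notin S & e u y]) ->
  (forall (S : {set T}) c, S \subset D -> S != set0 -> c \notin S ->
     c \in x |: D ->
     exists2 u, u \in S &
       0 < w u \/ exists y, [/\ y \in x |: D, y \notin S, y != c & e u y]) ->
  (forall u, u \in D -> d <= #|[set y in x |: D | e u y]| + w u) ->
  exists p, [/\ path e x p, uniq p, {subset p <= D}, 0 < size p &
    0 < w (last x p) /\ d <= size p + w (last x p)].
Proof.
move=> e_sym e_irr; have [n] := ubnP #|D|.
elim: n => // n IHn in D x w d * => leDn xD D0 Dout Dcut Ddeg.
pose closedA (S : {set T}) := [forall u in S, forall y in D, e u y ==> (y \in S)].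
pose closedB (S : {set T}) c := [&& c \in D, c \notin S &
  [forall u in S, (w u == 0) &&
     [forall y in D, e u y ==> ((y \in S) || (y == c))]]].
(* [F S] says that, once [x] is removed, [S] has at most one outer neighbour in the contracted
   graph. [D] itself qualifies, so a minimal [S] exists. *)
pose F (S : {set T}) :=
  [&& S != set0, S \subset D & closedA S || [exists c, closedB S c]].
have closedAP (S : {set T}) :
    (forall u y, u \in S -> y \in D -> e u y -> y \in S) -> closedA S.
  move=> H; apply/forall_inP=> u uS; apply/forall_inP=> y yD.
  by apply/implyP; apply: H.
have closedAE (S : {set T}) :
    closedA S -> forall u y, u \in S -> y \in D -> e u y -> y \in S.
  by move=> /forall_inP H u y /H/forall_inP /[apply] /implyP; apply.
have nclosedA (S : {set T}) : ~~ closedA S ->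
    exists u y, [/\ u \in S, y \in D, e u y & y \notin S].
  case/forall_inPn=> u uS /forall_inPn[y yD] /=; rewrite negb_imply => /andP[? ?].
  by exists u, y.
have nclosedB (S : {set T}) c : c \in D -> c \notin S -> ~~ closedB S c ->
    exists2 u, u \in S &
      0 < w u \/ exists y, [/\ y \in D, y \notin S, y != c & e u y].
  move=> cD cS; rewrite /closedB cD cS => /forall_inPn[u uS].
  rewrite /= negb_and -lt0n => /orP[wu|/forall_inPn[y yD /=]].
    by exists u => //; left.
  rewrite negb_imply negb_or => /and3P[euy yS yc].
  by exists u => //; right; exists y.
have FD : F D.
  by rewrite /F D0 subxx closedAP.
have [S /minsetP[FS minS] _] := minset_exists FD.
have {FD} [S0 SD SAB] := and3P FS.
(* By minimality a proper nonempty part of [S] has two outer neighbours; this supplies the cut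
   hypotheses for the induction. *)
have notF (U : {set T}) : U \subset S -> U != S -> U != set0 ->
    ~~ closedA U /\ forall c, ~~ closedB U c.
  move=> US UneqS U0.
  have : ~~ F U by apply: contra UneqS => FU; apply/eqP/minS.
  rewrite /F U0 (subset_trans US SD) /= negb_or negb_exists.
  by case/andP=> -> /forallP.
(* Both kinds of [S] are brought to one interface: [w'] counts the edges from [S] to its single
   outer neighbour, and an exit through [w'] is prolonged by [q] to an exit through [w] without loss
   in the length bound. *)
have [w' [Sdeg Sout Scut [u0 u0S wu0] Sext] [x' x'S exx']] :
    exists2 w' : T -> nat,
    [/\ forall u, u \in S -> d <= #|[set y in x |: S | e u y]| + w' u,
        forall U : {set T}, U \subset S -> U != S -> U != set0 ->
          exists u y, [/\ u \in U, y \in S, y \notin U & e u y],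
        forall (U : {set T}) c, U \subset S -> U != S -> U != set0 ->
          c \in S -> c \notin U -> exists2 u, u \in U &
          0 < w' u \/ exists y, [/\ y \in S, y \notin U, y != c & e u y],
        exists2 u, u \in S & 0 < w' u &
        forall u, u \in S -> 0 < w' u -> exists q,
          [/\ path e u q, uniq q, {subset q <= D :\: S}, 0 < w (last u q) &
              w' u <= size q + w (last u q)] ] &
    exists2 x', x' \in S & e x x'.
  have [SA|SnA] := boolP (closedA S).
    exists w; first split.
    - move=> u uS; apply: leq_trans (Ddeg u (subsetP SD u uS)) _.
      rewrite leq_add2r subset_leq_card //; apply/subsetP=> y.
      rewrite !inE => /andP[/orP[->//|yD] euy].
      by rewrite euy (closedAE _ SA u) ?orbT.
    - move=> U US UneqS U0; have [nA _] := notF U US UneqS U0.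
      have [u [y [uU yD euy yU]]] := nclosedA U nA.
      exists u, y; split=> //.
      by apply: (closedAE _ SA u) => //; apply: (subsetP US).
    - move=> U c US UneqS U0 cS cU; have [_ nB] := notF U US UneqS U0.
      have [u uU H] := nclosedB U c (subsetP SD c cS) cU (nB c).
      exists u => //; case: H => [|[y [yD yU yc euy]]]; [by left|right].
      exists y; split=> //.
      by apply: (closedAE _ SA u) => //; apply: (subsetP US).
    - have [u uS [//|]] := Dcut S x SD S0 (contra (subsetP SD x) xD) (setU11 _ _).
        by exists u.
      case=> y [yD yS yx euy]; case/negP: yS; apply: (closedAE _ SA u) => //.
      by move: yD; rewrite !inE (negPf yx).
    - by move=> u uS wu; exists [::].
    have [u [y [uS yD yS euy]]] := Dout S SD S0.
    exists u => //; rewrite e_sym; move: yD; rewrite !inE => /orP[/eqP<-//|yD].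
    by case/negP: yS; apply: (closedAE _ SA u).
  move: SAB; rewrite (negPf SnA) /= => /existsP[c SB].
  have [cD cS wS SBE] : [/\ c \in D, c \notin S, forall u, u \in S -> w u = 0 &
      forall u y, u \in S -> y \in D -> e u y -> y \notin S -> y = c].
    case/and3P: SB => cD cS /forall_inP H; split=> // [u /H/andP[/eqP]//|].
    move=> u y /H/andP[_ /forall_inP /[apply] /implyP/[apply]].
    by case: (y \in S) => //= /eqP.
  exists (fun u => nat_of_bool (e u c)); first split.
  - move=> u uS; apply: leq_trans (Ddeg u (subsetP SD u uS)) _.
    rewrite wS // addn0.
    apply: (@leq_trans #|[set y in x |: S | e u y] :|: [set y in [set c] | e u y]|).
      apply: subset_leq_card; apply/subsetP=> y; rewrite !inE.
      case/andP=> yxD euy; rewrite euy !andbT; case/orP: yxD => [->//|yD].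
      by case: (boolP (y \in S)) => yS; rewrite ?orbT // (SBE u y) // eqxx orbT.
    apply: leq_trans (leq_card_setU _ _).1 _; rewrite leq_add2l.
    case: (boolP (e u c)) => [_|nuc].
      rewrite -[X in _ <= X](cards1 c) subset_leq_card //; apply/subsetP=> y.
      by rewrite inE => /andP[].
    rewrite leqn0 cards_eq0; apply/eqP/setP=> y; rewrite !inE.
    by apply/andP=> -[/eqP->]; apply/negP.
  - move=> U US UneqS U0; have [_ nB] := notF U US UneqS U0.
    have cU : c \notin U by apply: contra cS; apply: (subsetP US).
    have [u uU H] := nclosedB U c cD cU (nB c).
    have uS := subsetP US u uU.
    move: H; rewrite wS // => -[//|[y [yD yU yc euy]]].
    exists u, y; split=> //; apply: contraTT yc => yS.
    by rewrite (SBE u y) // eqxx.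
  - move=> U c' US UneqS U0 c'S c'U; have [_ nB] := notF U US UneqS U0.
    have [u uU H] := nclosedB U c' (subsetP SD _ c'S) c'U (nB c').
    have uS := subsetP US u uU.
    exists u => //; move: H; rewrite wS // => -[//|[y [yD yU yc euy]]].
    case: (boolP (y \in S)) => yS; first by right; exists y.
    by left; rewrite -(SBE u y) ?euy.
  - have [u [y [uS yD euy yS]]] := nclosedA S SnA.
    by exists u; rewrite // -(SBE u y) ?euy.
  - move=> u uS; case: (boolP (e u c)) => // euc _.
    (* The extension enters [c] and stays in its component [R] of [D :\: S]. The cut hypothesis for
       [S :|: R] and [x] yields a vertex of positive weight, which cannot lie in [S]. *)
    pose e' := [rel a b | [&& e a b, a \in D :\: S & b \in D :\: S]].
    pose R := [set t | connect e' c t].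
    have cR : c \in R by rewrite inE connect0.
    have RD t : t \in R -> t \in D :\: S.
      rewrite inE => /connectP[p pp ->].
      case/lastP: p pp => [_|p z]; first by rewrite inE cS cD.
      by rewrite rcons_path last_rcons => /and4P[].
    have [z zR wz] : exists2 z, z \in R & 0 < w z.
      have [|||z] := Dcut (S :|: R) x _ _ _ (setU11 _ _).
      - by rewrite subUset SD; apply/subsetP=> t /RD; rewrite inE => /andP[].
      - by apply/set0Pn; exists c; rewrite inE cR orbT.
      - rewrite inE negb_or (contra (subsetP SD x) xD) /=.
        by apply/negP=> /RD; rewrite inE (negPf xD) andbF.
      rewrite inE => zSR [wz|[y [yD ySR yx ezy]]].
        case/orP: zSR => [/wS z0|zR]; last by exists z.
        by rewrite z0 in wz.
      move: yD ySR; rewrite !inE (negPf yx) /= negb_or => yD /andP[yS yR].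
      case/negP: yR; case/orP: zSR => [zS|zR].
        by rewrite (SBE z y).
      have zDS := RD z zR; move: zR; rewrite inE => /connect_trans; apply.
      by apply: connect1; rewrite /= ezy zDS inE yS yD.
    move: zR; rewrite inE => /connectP[p0 pp0 zE].
    case/shortenP: pp0 zE => q pq uq _ zE.
    have sq : {subset q <= D :\: S}.
      move=> t tq; apply: RD; rewrite inE; apply/connectP.
      case/path.splitP: tq pq => q1 q2; rewrite cat_path => /andP[pq1 _].
      by exists (rcons q1 t); rewrite ?last_rcons.
    exists (c :: q); split=> /=; rewrite -?zE //.
    + by rewrite euc; apply: sub_path pq => a b /and3P[].
    + by move=> t; rewrite inE => /predU1P[->|/sq//]; rewrite inE cS cD.
  (* An outer neighbour of [S] other than [c] can only be [x]. *)
  have [u uS] := Dcut S c SD S0 cS (setU1r _ cD).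
  rewrite wS // => -[//|[y [yD yS yc euy]]].
  exists u; rewrite // e_sym; move: yD; rewrite !inE => /orP[/eqP<-//|yD].
  by move: yc; rewrite (SBE u y) ?eqxx.
(* Here [S :\ x'] is empty and the induction hypothesis does not apply, but [x] is then the only
   neighbour of [x'] that [Sdeg] can count besides [w']. *)
have [S1|S1] := eqVneq S [set x'].
  have [q [pq uq sq wq le_q]] : exists q, [/\ path e x' q, uniq q,
      {subset q <= D :\: S}, 0 < w (last x' q) & w' x' <= size q + w (last x' q)].
    by apply: Sext => //; move: u0S; rewrite S1 inE => /eqP <-.
  exists (x' :: q); split=> //=.
  - by rewrite exx'.
  - by rewrite uq andbT; apply/negP=> /sq; rewrite inE x'S.
  - move=> y; rewrite inE => /predU1P[->|/sq]; first exact: (subsetP SD).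
    by rewrite inE => /andP[].
  - split=> //; rewrite addSn -add1n.
    apply: leq_trans (Sdeg _ x'S) (leq_add _ le_q).
    rewrite -(cards1 x) subset_leq_card //; apply/subsetP=> y; rewrite S1 !inE.
    by case/andP=> /orP[//|/eqP->]; rewrite e_irr.
(* Induction from [x'] into [S :\ x']: dropping [x] costs each degree at most one, hence [d.-1], and
   prepending [x'] to the path regains it. *)
have [p [pp up sp p0 [wp le_p]]] : exists p, [/\ path e x' p, uniq p,
    {subset p <= S :\ x'}, 0 < size p &
    0 < w' (last x' p) /\ d.-1 <= size p + w' (last x' p)].
  have E : x' |: S :\ x' = S by rewrite setD1K.
  have sub (U : {set T}) : U \subset S :\ x' -> U \subset S /\ U != S.
    rewrite subsetD1 => /andP[-> x'U]; split=> //.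
    by apply: contraNneq x'U => ->.
  apply: IHn => //; rewrite ?E.
  - rewrite -ltnS; apply: leq_trans leDn; rewrite ltnS.
    by apply: leq_trans (subset_leq_card SD); rewrite (cardsD1 x' S) x'S.
  - by rewrite !inE eqxx.
  - by apply: contra S1 => /eqP S1; rewrite -E S1 setU0.
  - by move=> U /sub[US US'] U0; apply: Sout.
  - by move=> U c /sub[US US'] U0 cU cS; apply: Scut.
  - move=> u; rewrite inE => /andP[_ uS].
    rewrite -subn1 leq_subLR; apply: leq_trans (Sdeg u uS) _.
    rewrite addnA leq_add2r -(cards1 x).
    apply: leq_trans (leq_card_setU _ _).1.
    apply: subset_leq_card; apply/subsetP=> y; rewrite !inE.
    by case: (y == x).
have spS y : y \in p -> (y \in S) && (y != x').
  by move=> /sp; rewrite !inE andbC.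
have lS : last x' p \in S.
  by case/lastP: p p0 spS {pp up sp wp le_p} => // p z _ /(_ z);
    rewrite mem_rcons mem_head last_rcons => /(_ isT)/andP[].
have [q [pq uq sq wq le_q]] := Sext _ lS wp.
exists (x' :: p ++ q); split=> //=.
- by rewrite exx' cat_path pp.
- rewrite cat_uniq up uq mem_cat negb_or andbT /= -andbA; apply/and3P; split.
  + by apply/negP=> /spS; rewrite eqxx andbF.
  + by apply/negP=> /sq; rewrite inE x'S.
  + by apply/hasPn=> y /sq; rewrite inE => /andP[yS _]; apply: contra yS => /spS/andP[].
- move=> y; rewrite inE mem_cat => /predU1P[->|/orP[/spS/andP[yS _]|/sq]].
  + exact: (subsetP SD).
  + exact: (subsetP SD).
  + by rewrite inE => /andP[].
- rewrite last_cat; split=> //; rewrite size_cat.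
  apply: leq_trans (leqSpred d) _; rewrite addSn ltnS -addnA.
  by apply: leq_trans le_p _; rewrite leq_add2l.
Qed.

(** * Keyrings from a cycle through a vertex of large degree *)

(** The leaves are the first [r] neighbours of [v] off [s]; they differ from [v] itself by
    irreflexivity. *)
Lemma keyring_of_cycle (G : sgraph) (v : G) (s : seq G) (r : nat) :
  uniq (v :: s) -> path (@adj G) v s -> adj (last v s) v ->
  r <= #|[set y | adj v y & y \notin s]| -> contains G (keyring (size s).+1 r).
Proof.
move=> us ps lsv; set L := [set y | _ & _] => le_rL.
have ltL (j : 'I_r) : j < size (enum L).
  by rewrite -cardE; apply: leq_trans (ltn_ord j) le_rL.
have inL (j : 'I_r) : nth v (enum L) j \in L by rewrite -mem_enum mem_nth.
pose f (x : 'I_(size s).+1 + 'I_r) :=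
  match x with inl i => nth v (v :: s) i | inr j => nth v (enum L) j end.
have succ_adj (i j : 'I_(size s).+1) : j = ordS i -> adj (f (inl i)) (f (inl j)).
  move=> ->; rewrite /f /=.
  have [lt_is|] := ltnP i (size s).
    by rewrite modn_small ?ltnS //; apply/(pathP v).
  move=> le_si; have -> : nat_of_ord i = size s.
    by apply/eqP; rewrite eqn_leq le_si -ltnS ltn_ord.
  by rewrite modnn -last_nth.
have leaf_adj (i : 'I_(size s).+1) (j : 'I_r) : val i == 0 ->
    adj (f (inl i)) (f (inr j)).
  by move=> /eqP i0; rewrite /f /= i0; have := inL j; rewrite inE => /andP[].
exists f; split=> [x y|x y].
  have neq (i : 'I_(size s).+1) (j : 'I_r) : f (inl i) <> f (inr j).
    rewrite /f => E; have := inL j; rewrite -E inE => /andP[avn].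
    apply/negP; rewrite negbK; have : nth v (v :: s) i \in v :: s by apply: mem_nth.
    by rewrite inE => /predU1P[E'|//]; rewrite E' adj_irrefl in avn.
  case: x y => [i|i] [j|j].
  - by move=> /(uniqP v us) H; congr inl; apply/val_inj/H; rewrite inE /= ltn_ord.
  - by move=> /neq.
  - by move=> /esym/neq.
  - move=> /(uniqP v (enum_uniq L)) H; congr inr; apply/val_inj/H; exact: ltL.
case: x y => [i|i] [j|j] //=; first 1 last.
- exact: leaf_adj.
- by move=> j0; rewrite adj_sym; apply: leaf_adj.
case/andP=> _ /orP[/eqP E|/eqP E]; first exact: succ_adj.
by rewrite adj_sym; apply: succ_adj.
Qed.

(** This finds the chord that shortens a cycle: the shortest prefix with [m] hits ends at a hit.
    Positivity of [m] makes the prefix nonempty, so that [last] returns a genuine entry and not the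
    default [x]. *)
Lemma prefix_count (T : eqType) (P : pred T) (x : T) (s : seq T) (m : nat) :
  0 < m <= count P s ->
  exists s1 s2, [/\ s = s1 ++ s2, count P s1 = m & P (last x s1)].
Proof.
case/andP=> m0; elim/last_ind: s => [|s y IHs]; first by case: m m0.
have [/IHs[s1 [s2 [-> <- Pl]]] _|lt_sm] := leqP m (count P s).
  by exists s1, (rcons s2 y); rewrite rcons_cat.
rewrite -cats1 count_cat /= addn0 => le_m.
exists (s ++ [:: y]), [::]; rewrite cats0 last_cat count_cat /= addn0.
by case: (P y) le_m => /= le_m; split=> //; lia.
Qed.

Lemma card_count (T : finType) (P : pred T) (s : seq T) :
  uniq s -> #|[set y in s | P y]| = count P s.
Proof.
move=> us; rewrite -size_filter -(card_uniqP (filter_uniq P us)).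
by apply: eq_card => y; rewrite !inE mem_filter andbC.
Qed.

(* If fewer than [r] neighbours of the hub [v] lie off the cycle, cut the cycle
   short at the neighbour of [v] that leaves exactly [r] of them outside. *)
Lemma keyring_of_hub (G : sgraph) (v : G) (s : seq G) (k r : nat) :
  uniq (v :: s) -> path (@adj G) v s -> adj (last v s) v -> 1 < size s ->
  k <= (size s).+1 + r -> r.+2 <= #|[set y | adj v y]| ->
  k <= #|[set y | adj v y]|.+1 ->
  exists l : nat, [/\ 3 <= l, k <= l + r & contains G (keyring l r)].
Proof.
move=> us ps lsv s2 le_ks; set d := #|_| => le_rd le_kd.
have splitN (t : seq G) : uniq t ->
    d = count (adj v) t + #|[set y | adj v y & y \notin t]|.
  move=> ut; rewrite -card_count // /d -(cardsID [set y in t]); congr (_ + _).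
    by apply: eq_card => y; rewrite !inE andbC.
  by apply: eq_card => y; rewrite !inE andbC.
have us' : uniq s by case/andP: us.
have [le_r|lt_r] := leqP r #|[set y | adj v y & y \notin s]|.
  exists (size s).+1; split=> //; exact: (keyring_of_cycle us ps).
have ds := splitN s us'.
have [|s1 [s3 [sE cs1 Pl]]] := @prefix_count _ (adj v) v s (d - r).
  rewrite subn_gt0 (leq_trans _ le_rd) ?ltnS // leq_subLR ds addnC leq_add2r.
  exact: ltnW.
have us1 : uniq (v :: s1).
  by move: us; rewrite sE -cat_cons cat_uniq => /and3P[].
have ps1 : path (@adj G) v s1 by move: ps; rewrite sE cat_path => /andP[].
have us1' : uniq s1 by case/andP: us1.
have le_s1 : d - r <= size s1 by rewrite -cs1 count_size.
have le_rd' : r <= d by rewrite (leq_trans _ le_rd) // -addn2 leq_addr.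
(* The prefix contains [d - r >= 2] neighbours of [v], so the new cycle has length at least 3, and
   with its [r] leaves at least [d + 1 >= k] edges. *)
exists (size s1).+1; split.
- by rewrite ltnS (leq_trans _ le_s1) // leq_subRL ?addn2.
- by apply: leq_trans le_kd _; rewrite addSn ltnS addnC -leq_subLR.
- apply: (keyring_of_cycle us1 ps1); first by rewrite adj_sym.
  by rewrite -(leq_add2l (d - r)) -{2}cs1 -splitN // subnK.
Qed.

(** * Long cycles through a prescribed vertex *)

(** The hit positions and their successors are disjoint sets of equal size, both inside the interval
    from [m] to [size s - m]. One hit guarantees that this interval is nonempty, so that the
    truncated subtraction is exact. *)
Lemma double_count_sparse (T : Type) (P : pred T) (x : T) (s : seq T) (m : nat) :
  (forall i, i < size s -> P (nth x s i) -> m <= i /\ i + m < size s) ->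
  (forall i, i.+1 < size s -> P (nth x s i) -> ~~ P (nth x s i.+1)) ->
  0 < count P s -> 2 * m + 2 * count P s <= (size s).+1.
Proof.
move=> Hm Hnext; pose J := [seq i <- iota 0 (size s) | P (nth x s i)].
have JP i : i \in J -> P (nth x s i) /\ i < size s.
  by rewrite mem_filter mem_iota => /andP[].
have -> : count P s = size J.
  by rewrite -[in LHS](mkseq_nth x s) /mkseq count_map size_filter.
move=> J0.
have sub : {subset J ++ map succn J <= iota m (size s - m - m).+1}.
  move=> j; rewrite mem_cat mem_iota => /orP[|/mapP[i]] /JP[Pi lt_i].
    by have := Hm j lt_i Pi; lia.
  by move=> ->; have := Hm i lt_i Pi; lia.
have uJ : uniq (J ++ map succn J).
  rewrite cat_uniq map_inj_uniq; last exact: succn_inj.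
  rewrite filter_uniq ?iota_uniq //= andbT; apply/hasPn=> _ /mapP[i Ji ->].
  apply/negP=> /JP[Pi1 lti]; have [Pi _] := JP i Ji.
  by have := Hnext i lti Pi; rewrite Pi1.
have := uniq_leq_size uJ sub; rewrite size_cat size_map size_iota.
have [i Ji] : exists i, i \in J.
  by case: J J0 {JP sub uJ} => // i ? _; exists i; rewrite mem_head.
have [Pi lti] := JP i Ji; have := Hm i lti Pi.
by move: (size J) (size s) => a b; clear; lia.
Qed.

(** The edge to [u], traversed back and forth, counts as a degenerate cycle, so there is a
    candidate; lengths are bounded by the number of vertices. *)
Lemma longest_cycle_through (T : finType) (e : rel T) (v u : T) :
  symmetric e -> irreflexive e -> e v u ->
  exists s, [/\ uniq (v :: s), path e v s, e (last v s) v, 0 < size s &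
    forall t, uniq (v :: t) -> path e v t -> e (last v t) v ->
      size t <= size s].
Proof.
move=> e_sym e_irr evu.
pose P n := [exists t : n.-tuple T, [&& uniq (v :: t), path e v t & e (last v t) v]].
have Pex (t : seq T) : uniq (v :: t) -> path e v t -> e (last v t) v -> P (size t).
  by move=> ut pt lt; apply/existsP; exists (in_tuple t); apply/and3P.
have P1 : P 1.
  apply: (Pex [:: u]); rewrite /= ?evu ?(e_sym u) // inE andbT.
  by apply: contraTneq evu => <-; rewrite e_irr.
have bound n : P n -> n <= #|T|.
  case/existsP=> t /and3P[/andP[_ ut] _ _].
  by rewrite -(size_tuple t) -(card_uniqP ut) max_card.
case: (ex_maxnP (ex_intro P 1 P1) bound) => n /existsP[s /and3P[us ps ls]] maxn.
exists s; split=> //; rewrite size_tuple; first exact: maxn.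
by move=> t ut pt lt; apply/maxn/Pex.
Qed.

(* A path of length [m] leaving a longest cycle at [v], whose end has [a]
   neighbours on the rest of the cycle, forces the cycle to have length at least
   [2 (m + a)]: these neighbours are at distance more than [m] from [v] in both
   directions, and no two of them are consecutive. *)
Lemma long_cycle_through (T : finType) (e : rel T) (A : {set T}) (v u : T) d :
  symmetric e -> irreflexive e ->
  (forall x y, e x y -> y \in A) ->
  (forall (S : {set T}) c, S \subset A -> S != set0 -> c \notin S ->
     c \in A -> c |: S != A ->
     exists x y, [/\ x \in S, y \notin S, y != c & e x y]) ->
  (forall x, x \in A -> d <= #|[set y | e x y]|) -> e v u ->
  exists s, [/\ uniq (v :: s), path e v s, e (last v s) v, 0 < size s &
    2 * d <= (size s).+1 \/ forall y, e v y -> y \in s].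
Proof.
move=> e_sym e_irr eA Acut Adeg evu.
have [s [us ps ls s0 smax]] := longest_cycle_through e_sym e_irr evu.
exists s; split=> //.
have [/forall_inP H|] := boolP [forall y in e v, y \in s]; first by right.
case/forall_inPn=> u0; rewrite unfold_in /= => evu0 u0s; left.
have [vs us'] : v \notin s /\ uniq s by case/andP: us.
have vA : v \in A by apply: (eA u); rewrite e_sym.
pose e' := [rel a b | [&& e a b, a \notin v :: s & b \notin v :: s]].
have e'_sym : symmetric e'.
  by move=> a b; rewrite /= e_sym [(a \notin _) && _]andbC.
pose D := [set t | connect e' u0 t].
have u0D : u0 \in D by rewrite inE connect0.
have u0vs : u0 \notin v :: s.
  rewrite inE (negPf u0s) orbF; by apply: contraTneq evu0 => ->; rewrite e_irr.
have Dvs t : t \in D -> t \notin v :: s.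
  rewrite inE => /connectP[p pp ->].
  case/lastP: p pp => [//|p z].
  by rewrite rcons_path last_rcons => /and4P[].
have DA t : t \in D -> t \in A.
  rewrite inE => /connectP[p pp ->].
  case/lastP: p pp => [_|p z]; first exact: (eA v).
  by rewrite rcons_path last_rcons => /and4P[_ /eA].
have Dnext a b : a \in D -> e a b -> b \notin v :: s -> b \in D.
  move=> aD eab bvs; have avs := Dvs a aD.
  move: aD; rewrite !inE => /connect_trans; apply; apply: connect1.
  by rewrite /= eab avs bvs.
have vD : v \notin D by apply/negP=> /Dvs; rewrite mem_head.
have D0 : D != set0 by apply/set0Pn; exists u0.
(* [D] is the component of [u0] off the cycle, entered from [v]; the weight counts edges to the rest
   of the cycle, which plays the contracted vertex. *)
have [|||p [pp up sp p0 [wp le_p]]] :=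
  @long_exit_path T e D v (fun z => count (e z) s) d e_sym e_irr vD D0 _ _ _.
- move=> S SD /set0Pn[t tS].
  have [u0S|u0S] := boolP (u0 \in S).
    exists u0, v; split=> //; rewrite ?setU11 1?e_sym //.
    by apply/negP=> /(subsetP SD); apply/negP.
  have [a [b [aS bD bS eab]]] : exists a b, [/\ a \in S, b \in D, b \notin S & e a b].
    have : connect e' t u0.
      by rewrite (sym_connect_sym e'_sym); have := subsetP SD t tS; rewrite inE.
    case/connectP=> q pq lq; elim: q t tS pq lq => [|b q IHq] a aS /=.
      by move=> _ E; rewrite E aS in u0S.
    case/andP=> /and3P[eab avs bvs] pq lq.
    have [bS|bS] := boolP (b \in S); first exact: IHq bS pq lq.
    by exists a, b; split=> //; apply: Dnext eab bvs; apply: (subsetP SD).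
  by exists a, b; split=> //; rewrite in_setU1 bD orbT.
- move=> S c SD S0 cS cvD.
  have [|||a [b [aS bS bc eab]]] := Acut S c _ S0 cS.
  + by apply/subsetP=> t /(subsetP SD)/DA.
  + by move: cvD; rewrite in_setU1 => /predU1P[->|/DA].
  (* A vertex of [s] witnesses [c |: S != A], since [c] and [S] lie in [v |: D]. *)
  + have [y ys evy] : exists2 y, y \in s & e v y.
      by case: (s) s0 ps => // y q _ /andP[evy _]; exists y; rewrite ?mem_head.
    apply: contraTneq (eA v y evy) => <-; rewrite in_setU1 negb_or; apply/andP; split.
      apply: contraTneq ys => ->; move: cvD; rewrite in_setU1 => /predU1P[->//|/Dvs].
      by rewrite inE negb_or => /andP[].
    by apply: contraL ys => /(subsetP SD)/Dvs; rewrite inE negb_or => /andP[].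
  exists a => //; have [bs|bs] := boolP (b \in s).
    by left; rewrite -has_count; apply/hasP; exists b.
  right; exists b; split=> //; rewrite in_setU1.
  have [//|bv] := eqVneq b v; apply: (Dnext a) => //; first exact: (subsetP SD).
  by rewrite inE (negPf bv).
- move=> t tD; apply: leq_trans (Adeg t (DA t tD)) _.
  rewrite -card_count //; apply: leq_trans (leq_card_setU _ _).1.
  apply: subset_leq_card; apply/subsetP=> y; rewrite inE => ety.
  apply/setUP; have [ys|ys] := boolP (y \in s); first by right; rewrite inE ys.
  left; rewrite inE ety andbT in_setU1; have [//|yv] := eqVneq y v.
  by apply: (Dnext t) => //; rewrite inE (negPf yv).
have zD : last v p \in D.
  by case/lastP: p p0 sp {pp up wp le_p} => // p z _ /(_ z);
    rewrite mem_rcons mem_head last_rcons => /(_ isT).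
set z := last v p in wp le_p zD.
have pvs y : y \in p -> y \notin v :: s by move=> /sp/Dvs.
suff: 2 * size p + 2 * count (e z) s <= (size s).+1.
  by apply: leq_trans; rewrite -mulnDr leq_mul2l le_p.
have split_at i : i < size s ->
    s = take i s ++ nth v s i :: drop i.+1 s.
  by move=> lti; rewrite -drop_nth // cat_take_drop.
apply: (double_count_sparse (x := v)) => // i lti ezi.
(* The path [p] can replace either arc of the cycle from [v] to [y]. These arcs have [i] and
   [size s - i - 1] inner vertices, and maximality makes both numbers at least [size p]. *)
- set y := nth v s i in ezi; have sE := split_at i lti.
  have ys : y \in s by apply: mem_nth.
  have pNs q : uniq q -> {subset q <= s} -> uniq (v :: p ++ q).
    move=> uq sq; rewrite /= mem_cat negb_or cat_uniq up uq andbT.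
    rewrite (contra (sq v) vs) !andbT; apply/andP; split.
      by apply/negP=> /pvs; rewrite mem_head.
    by apply/hasPn=> t /sq ts; apply/negP=> /pvs; rewrite inE ts orbT.
  have si : size (take i s) = i by rewrite size_takel // ltnW.
  have [[uy uyr] [pys lys] [pyr lyr]] :
      [/\ uniq (y :: drop i.+1 s) /\ uniq (y :: rev (take i s)),
          path e y (drop i.+1 s) /\ e (last y (drop i.+1 s)) v &
          path e y (rev (take i s)) /\ e (last y (rev (take i s))) v].
    move: us' ps ls; rewrite {1 2 3}sE cat_uniq cat_path last_cat /=.
    case/and3P=> u1 /norP[y1 _] /andP[y2 u2] /and3P[p1 l1 p2] l2.
    have : path e (last v (rcons (take i s) y)) (rev (belast v (rcons (take i s) y))).
      by rewrite rev_path (eq_path (e' := e)) ?rcons_path ?p1 // => a b; apply: e_sym.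
    rewrite last_rcons belast_rcons rev_cons rcons_path => /andP[p3 l3].
    by split; split; rewrite // ?y2 // rev_uniq mem_rev y1 u1.
  have sub1 : {subset y :: drop i.+1 s <= s}.
    by move=> t; rewrite inE => /predU1P[->//|/mem_drop].
  have sub2 : {subset y :: rev (take i s) <= s}.
    by move=> t; rewrite inE mem_rev => /predU1P[->//|/mem_take].
  split.
    have := smax _ (pNs _ uy sub1); rewrite cat_path last_cat /= pp ezi pys lys.
    by move=> /(_ isT isT); rewrite size_cat /= size_drop; clear -lti; lia.
  have := smax _ (pNs _ uyr sub2); rewrite cat_path last_cat /= pp ezi pyr lyr.
  move=> /(_ isT isT); rewrite size_cat /= size_rev si addnS addnC; exact.
(* Inserting [z] between two consecutive neighbours would lengthen the cycle. *)
- apply/negP=> ezi1; have sE := cat_take_drop i.+1 s.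
  have := smax (take i.+1 s ++ z :: drop i.+1 s).
  have -> : uniq (v :: take i.+1 s ++ z :: drop i.+1 s).
    rewrite -cat_cons (uniq_catCA (v :: take i.+1 s) [:: z]) cat1s cat_cons sE.
    by rewrite cons_uniq (Dvs z zD).
  move: ps ls; rewrite -{1 2}sE cat_path last_cat (drop_nth v) //.
  have lti' := ltnW lti; rewrite (take_nth v lti') last_rcons /= => /and3P[p1 _ p2] l2.
  rewrite cat_path last_cat p1 ?last_rcons /= e_sym ezi ezi1 p2 l2.
  move=> /(_ isT isT isT).
  rewrite size_cat /= size_rcons size_drop size_takel; last by rewrite ltnW // ltnW.
  by clear -lti; lia.
Qed.

(** * Edge density and minimal dense sets *)

(** Ordered pairs, so that the cardinality is twice the number of edges inside [A], that is, a sum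
    of degrees. *)
Definition arcs (G : sgraph) (A : {set G}) : {set G * G} :=
  [set p | [&& adj p.1 p.2, p.1 \in A & p.2 \in A]].

Definition nbrs (G : sgraph) (A : {set G}) (x : G) : {set G} := [set y in A | adj x y].

Lemma card_arcs (G : sgraph) (A : {set G}) : #|arcs A| = \sum_(x in A) #|nbrs A x|.
Proof.
under eq_bigr => x _ do rewrite -sum1_card.
rewrite pair_big_dep /= -sum1_card; apply: eq_bigl => p.
by rewrite !inE andbCA [adj _ _ && _]andbC.
Qed.

(** The fibre of [arcs] over an edge contains both orientations, which are distinct by
    irreflexivity. *)
Lemma double_num_edges_le (G : sgraph) : 2 * num_edges G <= #|arcs [set: G]|.
Proof.
set P := arcs _.
rewrite -[X in _ <= X]sum1_card (partition_big_imset (fun p => [set p.1; p.2])) /=.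
have -> : [set [set p.1; p.2] | p in P] = edges G.
  by apply/setP=> E; apply/imsetP/imsetP=> -[p pP ->]; exists p;
    rewrite // !inE ?andbT in pP *.
rewrite mulnC -sum_nat_const; apply: leq_sum => E /imsetP[[x y]].
rewrite !inE /= => axy ->.
rewrite sum1_card.
have xy : (x, y) != (y, x).
  by apply: contraTneq axy => -[-> _]; rewrite adj_irrefl.
rewrite -[X in X <= _](_ : #|[set (x, y); (y, x)]| = 2); last by rewrite cards2 xy.
apply: subset_leq_card; apply/subsetP=> p; rewrite !inE => /orP[] /eqP-> /=.
  by rewrite unfold_in /= !inE /= axy eqxx.
by rewrite unfold_in /= !inE /= adj_sym axy setUC eqxx.
Qed.

(* [b = 0]: average degree more than [K]; [b = 1]: the weaker bound
   [2 e > K (n - 1)], which is inherited by one of two pieces sharing a vertex. *)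
Definition dense (G : sgraph) (K : nat) (b : bool) (A : {set G}) :=
  (A != set0) && (K * #|A| < #|arcs A| + b * K).

Lemma dense_hub (G : sgraph) (K : nat) (A : {set G}) :
  dense K false A -> exists2 x, x \in A & K < #|nbrs A x|.
Proof.
case/andP=> _; rewrite mul0n addn0 card_arcs => lt_K.
apply/exists_inP; apply: contraLR lt_K; rewrite negb_exists_in -leqNgt.
move/forall_inP=> H; rewrite mulnC -sum_nat_const; apply: leq_sum => x /H.
by rewrite -leqNgt.
Qed.

(** With [n] vertices all of degree below [K], the degree sum is at most [n * (K - 1)] and at most
    [n * (n - 1)]. The first is at most [K * (n - 1)] if [K <= n], the second if [n < K]. *)
Lemma dense_weak_hub (G : sgraph) (K : nat) (A : {set G}) :
  dense K true A -> exists2 x, x \in A & K <= #|nbrs A x|.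
Proof.
case/andP=> A0; rewrite mul1n card_arcs => lt_K.
apply/exists_inP; apply: contraLR lt_K; rewrite negb_exists_in -leqNgt.
move/forall_inP=> H.
have le1 : \sum_(x in A) #|nbrs A x| <= #|A| * K.-1.
  by rewrite -sum_nat_const; apply: leq_sum => x /H; rewrite -ltnNge; case: (K).
have le2 : \sum_(x in A) #|nbrs A x| <= #|A| * #|A|.-1.
  rewrite -sum_nat_const; apply: leq_sum => x xA.
  rewrite [X in _ <= X.-1](cardsD1 x) xA /=; apply: subset_leq_card.
  apply/subsetP=> y; rewrite !inE => /andP[-> axy]; rewrite andbT.
  by apply: contraTneq axy => ->; rewrite adj_irrefl.
have K0 : 0 < K.
  by case/set0Pn: A0 => x /H; rewrite -ltnNge; apply: leq_ltn_trans.
move: le1 le2 A0 K0; rewrite -card_gt0; move: (#|A|) (\sum_(x in A) _) => n m.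
case: n K {H} => // n [//|K] /= le1 le2 _ _.
have [le_Kn|lt_nK] := leqP K.+1 n.+1; [clear -le1 le_Kn | clear -le2 lt_nK]; nia.
Qed.

(** Deleting [x] removes [2 * #|nbrs A x|] arcs and lowers the bound by [K]; were the degree small,
    the rest would still be dense. The rest is nonempty because a singleton has no arcs and is not
    dense. *)
Lemma core_degree (G : sgraph) (K : nat) (b : bool) (A : {set G}) (x : G) :
  minset (dense K b) A -> x \in A -> K < 2 * #|nbrs A x|.
Proof.
move=> /minsetP[/andP[A0 dA] minA] xA.
have cA : #|A| = #|A :\ x|.+1 by rewrite (cardsD1 x) xA.
have le_arcs : #|arcs A| <= #|arcs (A :\ x)| + 2 * #|nbrs A x|.
  apply: (@leq_trans #|arcs (A :\ x) :|: ([set (x, y) | y in nbrs A x] :|: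
      [set (y, x) | y in nbrs A x])|).
    apply: subset_leq_card; apply/subsetP=> -[y z]; rewrite !inE /=.
    case/and3P=> ayz yA zA; rewrite ayz yA zA !andbT /=.
    have [yx|yx] := eqVneq y x.
      by rewrite yx (imset_f (fun y => (x, y))) ?orbT // inE zA -yx.
    have [zx|zx] := eqVneq z x; rewrite //= zx.
    by rewrite (imset_f (fun y => (y, x))) ?orbT // inE yA -zx adj_sym.
  apply: leq_trans (leq_card_setU _ _).1 _; rewrite leq_add2l.
  apply: leq_trans (leq_card_setU _ _).1 _; rewrite mul2n -addnn.
  by apply: leq_add; apply: leq_imset_card.
have [A1|A1] := eqVneq (A :\ x) set0.
  have arcs0 : arcs A = set0.
    apply/setP=> -[y z]; rewrite !inE /=; apply/negP=> /and3P[ayz yA zA].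
    have := setD1K xA; rewrite A1 setU0 => AE.
    by move: yA zA ayz; rewrite -AE => /set1P-> /set1P->; rewrite adj_irrefl.
  move: dA; rewrite arcs0 cA A1 !cards0; case: (b); rewrite ?mul0n ?mul1n ?muln1 ?ltnn //.
have /negP : ~ dense K b (A :\ x).
  by move=> /minA/(_ (subsetDl _ _)) AE; move: cA; rewrite AE; clear; lia.
rewrite /dense A1 /= -leqNgt; move: dA; rewrite cA mulnS.
move: le_arcs; move: #|arcs A| #|arcs (A :\ x)| #|nbrs A x| (b * K) (K * _).
by clear; lia.
Qed.

(** Otherwise [c] separates [S] from the rest, and every arc lies in [c |: S] or in [A :\: S].
    Neither piece is dense, by minimality; they share only [c], so their bounds [K * (n - 1)] add up
    to that of [A], a contradiction. *)
Lemma core_cut (G : sgraph) (K : nat) (A S : {set G}) (c : G) :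
  minset (dense K true) A -> S \subset A -> S != set0 -> c \notin S ->
  c \in A -> c |: S != A ->
  exists x y, [/\ x \in S, y \in A, y \notin S, y != c & adj x y].
Proof.
move=> /minsetP[/andP[A0 dA] minA] SA S0 cS cA SneqA.
have [/exists_inP[x xS /exists_inP[y]]|noarc] :=
    boolP [exists x in S, exists y in A :\: (c |: S), adj x y].
  by rewrite !inE negb_or -andbA => /and3P[yc yS yA] axy; exists x, y.
have noarcE x y : x \in S -> y \in A -> adj x y -> y \in c |: S.
  move=> xS yA axy; apply: contraNT noarc => yS; apply/exists_inP; exists x => //.
  by apply/exists_inP; exists y; rewrite // inE yS.
have le_arcs : #|arcs A| <= #|arcs (c |: S)| + #|arcs (A :\: S)|.
  apply: leq_trans (leq_card_setU _ _).1; apply: subset_leq_card.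
  apply/subsetP=> -[x y]; rewrite !in_setU !in_set /= => /and3P[axy xA yA].
  rewrite axy xA yA !andbT /=.
  have [xS|xS] := boolP (x \in S).
    by have := noarcE x y xS yA axy; rewrite !inE => ->; rewrite orbT.
  have [yS|yS] := boolP (y \in S); last by rewrite orbT.
  have := noarcE y x yS xA; rewrite adj_sym axy => /(_ isT).
  by rewrite !inE (negPf xS) orbF => ->; rewrite ?yS ?orbT.
have card_A : #|A| = #|S| + #|A :\: S|.
  by rewrite -(cardsID S A) (setIidPr SA).
have nd1 : ~~ dense K true (c |: S).
  apply: contra SneqA => /minA -> //.
  by rewrite subUset sub1set cA.
have nd2 : ~~ dense K true (A :\: S).
  apply/negP=> /minA/(_ (subsetDl _ _)) AE; move: card_A; rewrite AE.
  by move: S0; rewrite -card_gt0; clear; lia.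
have c0 : A :\: S != set0 by apply/set0Pn; exists c; rewrite inE cS.
have c1 : c |: S != set0 by apply/set0Pn; exists c; rewrite setU11.
exfalso; move: nd1 nd2 dA; rewrite /dense c0 c1 /= -!leqNgt cardsU1 cS card_A.
rewrite !mul1n !mulnDr [nat_of_bool _]/= muln1; move: le_arcs.
move: #|arcs A| #|arcs (c |: S)| #|arcs (A :\: S)| (K * #|S|).
by clear; lia.
Qed.

(** * Keyrings with a single leaf *)

(* The case [k = 3]: the end of a longest path from the hub [v] closes a cycle,
   which either contains [v] or has a pendant edge along the path. *)
Lemma keyring_one_leaf (G : sgraph) (A : {set G}) (v : G) :
  v \in A -> 2 < #|nbrs A v| -> (forall x, x \in A -> 1 < #|nbrs A x|) ->
  exists l : nat, [/\ 3 <= l, 3 <= l + 1 & contains G (keyring l 1)].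
Proof.
move=> vA dv dA.
pose P n := [exists t : n.-tuple G,
  [&& uniq (v :: t), path (@adj G) v t & all [in A] t]].
have P0 : P 0 by apply/existsP; exists [tuple].
have bound n : P n -> n <= #|G|.
  case/existsP=> t /and3P[/andP[_ ut] _ _].
  by rewrite -(size_tuple t) -(card_uniqP ut) max_card.
case: (ex_maxnP (ex_intro P 0 P0) bound) => n /existsP[s /and3P[us ps sA]] maxn.
have zA : last v s \in A.
  by have := mem_last v s; rewrite inE => /predU1P[->//|]; apply: (allP sA).
have zmax y : y \in nbrs A (last v s) -> y \in v :: s.
  rewrite inE => /andP[yA azy]; apply/negPn/negP=> yvs.
  have /maxn : P n.+1; last by rewrite ltnn.
  apply/existsP; exists [tuple of rcons s y].
  apply/and3P; split=> /=; rewrite ?rcons_path ?ps ?all_rcons ?yA //.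
  by rewrite -[_ && _]/(uniq (rcons (v :: s) y)) rcons_uniq yvs.
(* The tuple is replaced by a plain sequence, so that its last entry can be split off. *)
have {maxn bound P P0} [t tE] : exists t : seq G, t = s by exists s.
move: us ps sA zA zmax; rewrite -tE {s tE n}.
case/lastP: t => [|s z].
  move=> _ _ _ _ zmax; have /card_gt0P[y yN] : 0 < #|nbrs A v| by apply: ltn_trans dv.
  have := zmax y yN; rewrite mem_seq1 => /eqP yv.
  by move: yN; rewrite inE yv adj_irrefl andbF.
rewrite last_rcons rcons_path => us /andP[ps lsz] sA zA zmax.
have [y yN ypred] : exists2 y, y \in nbrs A z & y != last v s.
  have /card_gt1P[a [b [aN bN ab]]] := dA z zA.
  have [al|al] := eqVneq a (last v s); last by exists a.
  by exists b => //; rewrite -al eq_sym.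
have azy : adj z y by move: yN; rewrite inE => /andP[].
have : y \in v :: s.
  have := zmax y yN; rewrite -rcons_cons mem_rcons inE => /predU1P[yz|//].
  by rewrite yz adj_irrefl in azy.
rewrite inE => /predU1P[yv|].
  have s0 : 0 < size s by case: (s) ypred => //; rewrite yv eqxx.
  have dG : 2 < #|[set w | adj v w]|.
    apply: leq_trans dv _; apply: subset_leq_card; apply/subsetP=> w.
    by rewrite !inE => /andP[].
  apply: (@keyring_of_hub G v (rcons s z) 3 1) => //.
  - by rewrite rcons_path ps.
  - by rewrite last_rcons -yv.
  - by rewrite size_rcons ltnS.
  - by rewrite size_rcons; clear -s0; lia.
  - exact: ltnW.
move=> ys; case/splitPr: ys us ps lsz ypred {sA zA zmax} => s2 s3.
rewrite rcons_cat rcons_cons -cat_cons cat_uniq cat_path last_cat /=.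
case/and3P=> _ /norP[_ disj] uys3 /and3P[_ ay ps3] lsz ypred.
(* The cycle runs from [y] through [s3] to [z]; as [y] is not the predecessor of [z], [s3] is
   nonempty and the length is at least 3. The leaf is the path vertex before [y]. *)
have s30 : 0 < size s3 by case: (s3) ypred => //=; rewrite eqxx.
exists (size (rcons s3 z)).+1; rewrite addn1 size_rcons; split=> //.
rewrite -(size_rcons s3 z); apply: (@keyring_of_cycle G y (rcons s3 z)) => //.
  by rewrite rcons_path ps3.
  by rewrite last_rcons.
apply/card_gt0P; exists (last v s2); rewrite inE adj_sym ay.
by apply: contra disj => H; apply/hasP; exists (last v s2); rewrite // mem_last.
Qed.

(** * From a dense core to the keyring *)

Theorem theorem3 (k r : nat) (hk : 0 < k) (hr : 0 < r) (hrk : 2 * r <= k - 1)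
  (G : sgraph) (hG : (k - 1) * num_vertices G < 2 * num_edges G) :
  exists l : nat, [/\ 3 <= l, k <= l + r & contains G (keyring l r)].
Proof.
have core b : exists A : {set G}, minset (dense (k - 1) b) A.
  have [|A minA _] := @minset_exists _ (dense (k - 1) b) [set: G]; last by exists A.
  have lt_arcs := leq_trans hG (double_num_edges_le G).
  rewrite /dense cardsT (leq_trans lt_arcs (leq_addr _ _)) andbT -card_gt0.
  rewrite cardsT lt0n; apply: contraTneq lt_arcs => G0.
  rewrite -leqNgt; apply: leq_trans (leq0n _).
  by apply: leq_trans (max_card _) _; rewrite card_prod G0.
(* For [k = 3] a hub of degree [r + 2 = 3] is required, which the weak bound does not give: a
   triangle is a minimal weakly dense set. Strict density provides it. *)
have [k3|k_neq3] := eqVneq k 3.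
  have r1 : r = 1 by clear -hr hrk k3; lia.
  subst k r; have [A minA] := core false.
  have [v vA dv] := dense_hub (minsetp minA).
  apply: (keyring_one_leaf vA dv) => x xA.
  by have := core_degree minA xA; clear; lia.
have k4 : 3 < k by clear -hr hrk k_neq3; lia.
have [A minA] := core true.
have [v vA dv] := dense_weak_hub (minsetp minA).
(* Cuts and degrees are controlled only inside the core, so the cycle is sought there; the leaves
   may lie anywhere in [G]. *)
pose e := [rel x y | [&& adj x y, x \in A & y \in A]].
have e_adj : subrel e (@adj G) by move=> x y /and3P[].
have nbrsE x : x \in A -> [set y | e x y] = nbrs A x.
  by move=> xA; apply/setP=> y; rewrite !inE /= xA andbC.
have [u uN] : exists u, u \in nbrs A v.
  by apply/card_gt0P; apply: leq_trans dv; clear -k4; lia.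
(* [core_degree] reads [k - 1 < 2 * #|nbrs A x|], so degrees are at least [k / 2] rounded up, and
   twice this is at least [k]. *)
have [||||||s [us ps ls s0 large]] :=
    @long_cycle_through G e A v u (uphalf k).
- by move=> x y; rewrite /= adj_sym [(x \in A) && _]andbC.
- by move=> x; rewrite /= adj_irrefl.
- by move=> x y /and3P[].
- move=> S c SA S0 cS cA cSA.
  have [x [y [xS yA yS yc axy]]] := core_cut minA SA S0 cS cA cSA.
  by exists x, y; split=> //; rewrite /= axy yA (subsetP SA).
- move=> x xA; rewrite nbrsE // leq_uphalf_double -mul2n.
  by have := core_degree minA xA; clear -k4; lia.
- by move: uN; rewrite inE /= vA => /andP[-> ->].
have le_ks : k <= (size s).+1.
  case: large => [le_ks|sub].
    apply: leq_trans le_ks; rewrite mul2n -[X in X <= _]odd_double_half uphalf_half.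
    by rewrite doubleD leq_add2r; case: (odd k).
  have : #|nbrs A v| <= size s.
    apply: leq_trans (card_size s); apply: subset_leq_card; apply/subsetP=> y.
    by rewrite inE => /andP[yA avy]; apply: sub; rewrite /= avy vA yA.
  by move: dv; clear; lia.
have dG : k - 1 <= #|[set y | adj v y]|.
  apply: leq_trans dv _; apply: subset_leq_card; apply/subsetP=> y.
  by rewrite !inE => /andP[].
apply: (@keyring_of_hub G v s k r) => //.
- exact: sub_path ps.
- exact: e_adj.
- by clear -k4 le_ks; lia.
- by apply: leq_trans le_ks _; rewrite leq_addr.
- by apply: leq_trans dG; clear -k4 hr hrk; lia.
- by move: dG; clear; lia.
Qed.
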